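(* For every integer $h\ge 1$ we have $$C_h(Q)\le \frac{2h^2}{\log 2}\qquad\text{for all integers } Q\ge 2 .$$ Moreover, this upper bound is always attained: for every integer $h\ge 1$, $C_h(2)=\dfrac{2h^2}{\log 2}$.
   Context: For an integer $Q\ge 2$, let $F_Q=\{a/q: 1\le a\le q\le Q,\ \gcd(a,q)=1\}$ be the $Q$-th Farey sequence, $N=N(Q)=|F_Q|$, and write $F_Q=\{\gamma_1<\gamma_2<\dots<\gamma_N\}$. Set $\gamma_0=0$ and extend periodically to all indices $j>N$ by $\gamma_j=\gamma_{j \bmod N}+\lfloor j/N\rfloor$; in particular $\gamma_{j+N}=\gamma_j+1$. For an integer $h\ge 1$ define $$D_{2,h}(Q)=\sum_{j=1}^{N}(\gamma_{j+h}-\gamma_j)^2,\qquad C_h(Q)=\frac{D_{2,h}(Q)\,Q^2}{\log Q}.$$ Here $\log$ is the natural logarithm. *)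

(* Defs.v *)
From HB Require Import structures.
From mathcomp Require Import all_boot all_order all_algebra.
From mathcomp Require Import all_classical all_reals all_analysis.

Set Implicit Arguments.
Unset Strict Implicit.
Unset Printing Implicit Defensive.

Import Order.TTheory GRing.Theory Num.Theory.

Local Open Scope ring_scope.

(* The Farey fractions of order Q in ]0, 1], listed increasingly; coprimality
   makes the enumerated fractions pairwise distinct. *)
Definition farey (Q : nat) : seq rat :=
  sort <=%R [seq (a%:R / q%:R : rat) | q <- iota 1 Q,
                                      a <- [seq a <- iota 1 q | coprime a q]].

Definition farey_card (Q : nat) : nat := size (farey Q).

(* Consing 0 makes the 0-based indexing of seq agree with gamma_0 = 0 and with
   the 1-based enumeration gamma_1 < ... < gamma_N. *)
Definition farey_gamma (Q j : nat) : rat :=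
  let N := farey_card Q in
  if (j <= N)%N then (0 :: farey Q)`_j
  else (0 :: farey Q)`_(j %% N) + (j %/ N)%:R.

Definition D2 (h Q : nat) : rat :=
  \sum_(1 <= j < (farey_card Q).+1)
     (farey_gamma Q (j + h) - farey_gamma Q j) ^+ 2.

Definition C (R : realType) (h Q : nat) : R :=
  ratr (D2 h Q) * Q%:R ^+ 2 / ln Q%:R.

(* Main.v *)
Require Import Defs.
From mathcomp Require Import all_boot all_order all_algebra.
From mathcomp Require Import all_classical all_reals all_analysis.
From mathcomp Require Import ring lra zify.

Import Order.TTheory GRing.Theory Num.Theory.

Local Open Scope ring_scope.

(** By Cauchy-Schwarz and the periodicity of the gaps
    gamma_(j+1) - gamma_j, the sum D_(2,h) is at most h^2 D_(2,1)
    ([D2_le]), so the problem is to bound D_(2,1), with equality at Q = 2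
    because the two gaps of F_2 are equal ([D2_2]).

    Neighbours a/q < b/r in F_Q satisfy b q - a r = 1 and q + r > Q
    ([farey_neighbours]), so their gap is 1/(q r), and the pair of
    denominators determines the neighbours ([unimodular_inj]). Hence D_(2,1)
    is at most the sum S(Q) of 1/(q r)^2 over the coprime pairs q, r <= Q with
    q + r > Q ([sum_sqr_gap_le]).

    When Q grows from n to n+1, the pairs with q + r = n+1 are replaced by the
    pairs (q, n+1) and (n+1, r): this is the insertion of mediants. As
    1/(q r) = 1/(q (n+1)) + 1/((n+1) r) when q + r = n+1, the sum of the
    1/(q r) never changes and stays equal to 1 ([pair_sum_inv_prod]), while
    the sum of squares loses the cross terms:
    S(n) - S(n+1) = 4/(n+1)^3 * (sum of 1/q over q <= n coprime to n+1)
    ([sqr_pair_sumS]). Since 1/(q r) <= 1/Q, the first fact gives S(Q) <= 1/Q,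
    so S(Q) is the sum of all later losses; dropping the coprimality condition
    and comparing with a telescoping sum yields S(Q) <= (2 H_Q + 1)/Q^2, where
    H_Q is the harmonic sum ([sqr_pair_sum_le]).

    Finally (2 H_Q + 1) log 2 <= 2 log Q for Q >= 16: it holds at 16 = 2^4,
    where log Q / log 2 is explicit, and log 2 <= 1 makes it hereditary
    ([harmonic_sum_ln]). For 2 <= Q < 16 the recurrence gives S(Q) numerically,
    and Q^2 S(Q) is compared with an integer multiple of 1/2 below
    2 log Q / log 2 ([sqr_pair_sum_small]). *)

(** * Neighbours in a Farey sequence *)

(** Solutions (c, d) of c q - a d = 1 exist by Bezout and form a progression
    with step (a, q), so one of them has its denominator d in the window
    ]Q - q, Q]. The fraction z = c/d turns out to be the successor of x. *)
Lemma unimodular_frac (x : rat) (Q : nat) : denq x <= Q%:Z ->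
  exists z : rat, [/\ x < z, denq z <= Q%:Z, Q%:Z < denq x + denq z
                   & numq z * denq x - numq x * denq z = 1].
Proof.
move=> xQ; set a := numq x; set q := denq x.
have q0 : 0 < q by exact: denq_gt0.
have [[u v] /= uv] := coprimezP _ _ (coprime_num_den x : coprimez a q).
(* The shift by k steps makes Q - d the remainder of Q + u modulo q. *)
set k := ((Q%:Z + u) %/ q)%Z.
pose d := k * q - u; pose c := v + k * a.
have det : c * q - a * d = 1 by rewrite -uv /c /d; ring.
have [m0 mq] : 0 <= Q%:Z - d /\ Q%:Z - d < q.
  have -> : Q%:Z - d = ((Q%:Z + u) %% q)%Z.
    by have := divz_eq (Q%:Z + u) q; rewrite -/k /d; lia.
  by rewrite modz_ge0 ?ltz_pmod //; lia.
have d0 : 0 < d by move: xQ; rewrite -/q; lia.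
have cd : coprime `|c| `|d|.
  by apply/(coprimezP c d); exists (q, - a); rewrite /= -det; ring.
have numz : numq (c%:~R / d%:~R) = c by rewrite coprimeq_num // gtr0_sg // mul1r.
have denz : denq (c%:~R / d%:~R) = d.
  by rewrite coprimeq_den // gt_eqF // gtr0_norm.
exists (c%:~R / d%:~R); rewrite numz denz; split=> //; [|lia|lia].
by rewrite /Order.lt /= lt_ratE numz denz -/a -/q; lia.
Qed.

(** The successor y can only be the fraction z of [unimodular_frac]: a fraction
    strictly between x and z has a denominator at least denq x + denq z. *)
Lemma farey_neighbours (x y : rat) (Q : nat) :
  denq x <= Q%:Z -> denq y <= Q%:Z -> x < y ->
  (forall z, x < z -> denq z <= Q%:Z -> y <= z) ->
  numq y * denq x - numq x * denq y = 1 /\ Q%:Z < denq x + denq y.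
Proof.
move=> xQ yQ xy min_y; have [z [xz zQ Qxz det]] := unimodular_frac x Q xQ.
suff -> : y = z by [].
have := min_y z xz zQ; rewrite le_eqVlt => /orP[/eqP//|].
move: xy; rewrite /Order.lt /= !lt_ratE => xy yz.
have := denq_gt0 x; have := denq_gt0 z.
move: xy yz det Qxz yQ; move: (numq x) (numq y) (numq z) (denq x) (denq y) (denq z).
move=> a b c q r d aq bd det Qqd rQ d0 q0; exfalso.
(* The denominator of y is a positive integer combination of those of x and z. *)
have : r = q * (c * r - b * d) + d * (b * q - a * r) by rewrite -[LHS]mul1r -det; ring.
have h1 : 1 <= c * r - b * d by lia.
have h2 : 1 <= b * q - a * r by lia.
nia.
Qed.

Lemma unimodular_diff (x y : rat) : numq y * denq x - numq x * denq y = 1 ->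
  y - x = ((denq x)%:~R * (denq y)%:~R)^-1.
Proof.
move=> /(congr1 (fun k : int => k%:~R : rat)).
rewrite rmorphB !rmorphM /= !numqE => det.
have x0 : (denq x)%:~R != 0 :> rat by rewrite intr_eq0 denq_neq0.
have y0 : (denq y)%:~R != 0 :> rat by rewrite intr_eq0 denq_neq0.
apply: (mulIf (mulf_neq0 x0 y0)); rewrite mulVf ?mulf_neq0 //.
by rewrite -[RHS]det; ring.
Qed.

(** Modulo the denominator of x, the numerator of x is minus the inverse of the
    denominator of y, which determines it since it lies in [0, denq x[. *)
Lemma unimodular_inj (x y x' y' : rat) :
  0 <= x < 1 -> 0 <= x' < 1 ->
  numq y * denq x - numq x * denq y = 1 ->
  numq y' * denq x' - numq x' * denq y' = 1 ->
  denq x = denq x' -> denq y = denq y' -> x = x'.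
Proof.
move=> /andP[x0 x1] /andP[x0' x1'] det det' dx dy.
apply/eqP; rewrite rat_eqE dx eqxx andbT.
have [n0 n0'] : 0 <= numq x /\ 0 <= numq x' by rewrite !numq_ge0.
move: x1 x1'; rewrite /Order.lt /= !lt_ratE !mulr1 !mul1r dx => n1 n1'.
have d0 := denq_gt0 x'.
have dvd : (denq x' %| (numq x - numq x') * denq y')%Z.
  apply/dvdzP; exists (numq y - numq y'); move: det det'; rewrite dx dy; lia.
have cop : coprimez (denq x') (denq y').
  by apply/coprimezP; exists (numq y', - numq x') => /=; rewrite -det'; ring.
move: dvd; rewrite Gauss_dvdzl // => /dvdzP[k Ek].
have k0 : k = 0 by nia.
by move: Ek; rewrite k0 mul0r => /eqP; rewrite subr_eq0.
Qed.

(** * Sums over the denominators of neighbours *)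

Lemma ler_sum_uniq_sub (T : eqType) (F : T -> rat) (s t : seq T) :
  uniq s -> uniq t -> {subset s <= t} -> (forall x, 0 <= F x) ->
  \sum_(x <- s) F x <= \sum_(x <- t) F x.
Proof.
move=> us ut st F0.
have pe : perm_eq s [seq x <- t | x \in s].
  apply: uniq_perm; rewrite ?filter_uniq // => x.
  by rewrite mem_filter; case: (boolP (x \in s)) => // /st ->.
rewrite (perm_big _ pe) big_filter big_mkcond; apply: ler_sum => x _; by case: ifP.
Qed.

(** The index pairs are the denominators of neighbours in F_Q, where 0 and the
    period 1 are included. *)
Definition pair_sum (F : nat -> nat -> rat) (Q : nat) : rat :=
  \sum_(1 <= q < Q.+1) \sum_(1 <= r < Q.+1 | coprime q r && (Q < q + r)%N) F q r.

Lemma ler_pair_sum (F G : nat -> nat -> rat) (n : nat) :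
  (forall q r, (0 < q)%N -> (0 < r)%N -> (n < q + r)%N -> F q r <= G q r) ->
  pair_sum F n <= pair_sum G n.
Proof.
move=> FG; rewrite /pair_sum big_nat [X in _ <= X]big_nat.
apply: ler_sum => q /andP[q1 _]; rewrite big_nat_cond [X in _ <= X]big_nat_cond.
by apply: ler_sum => r /andP[/andP[r1 _] /andP[_ nqr]]; exact: FG.
Qed.

Lemma pair_sum_seq (F : nat -> nat -> rat) (Q : nat) :
  pair_sum F Q = \sum_(p <- [seq (q, r) | q <- iota 1 Q,
                         r <- [seq r <- iota 1 Q | coprime q r && (Q < q + r)%N]])
     F p.1 p.2.
Proof.
rewrite big_allpairs_dep /pair_sum /index_iota subn1 /=.
by apply: eq_bigr => q _; rewrite big_filter.
Qed.

Lemma coprime_subr (n q : nat) : (q <= n)%N -> coprime q (n - q) = coprime q n.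
Proof. by move=> qn; rewrite -[in RHS](subnK qn) addnC /coprime gcdnDl. Qed.

(** Inserting the mediants of denominator n+1: a pair with q + r = n+1 leaves,
    and the pairs (q, n+1) and (n+1, r) enter. *)
Lemma pair_sumS (F : nat -> nat -> rat) (n : nat) : (0 < n)%N ->
  pair_sum F n.+1 + \sum_(1 <= q < n.+1 | coprime q n.+1) F q (n.+1 - q)%N =
  pair_sum F n + \sum_(1 <= q < n.+1 | coprime q n.+1) (F q n.+1 + F n.+1 q).
Proof.
move=> n0; rewrite /pair_sum big_nat_recr //=.
have row q : (1 <= q < n.+1)%N ->
    \sum_(1 <= r < n.+2 | coprime q r && (n.+1 < q + r)%N) F q r
     + (if coprime q n.+1 then F q (n.+1 - q)%N else 0) =
    \sum_(1 <= r < n.+1 | coprime q r && (n < q + r)%N) F q r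
     + (if coprime q n.+1 then F q n.+1 else 0).
  case/andP=> q1 qn.
  rewrite (big_mkcond (fun r => coprime q r && (n.+1 < q + r)%N)) big_nat_recr //=.
  have -> : (n.+1 < q + n.+1)%N by lia.
  rewrite andbT addrAC; congr (_ + _).
  have qr : (n.+1 - q \in index_iota 1 n.+1)%N by rewrite mem_index_iota; lia.
  rewrite [RHS]big_mkcond /= [RHS](bigD1_seq _ qr) ?iota_uniq //=.
  rewrite [X in X + _ = _](bigD1_seq _ qr) ?iota_uniq //=.
  rewrite subnKC ?ltnn ?andbF ?ltnSn ?andbT ?add0r ?coprime_subr 1?addrC; try lia.
  congr (_ + _); rewrite big_seq_cond [RHS]big_seq_cond.
  apply: eq_bigr => r; rewrite mem_index_iota => /andP[/andP[r1 rn] /eqP rq].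
  by have -> : (n.+1 < q + r)%N = (n < q + r)%N by apply/idP/idP; lia.
have last_row :
    \sum_(1 <= r < n.+2 | coprime n.+1 r && (n.+1 < n.+1 + r)%N) F n.+1 r =
    \sum_(1 <= q < n.+1 | coprime q n.+1) F n.+1 q.
  rewrite big_mkcond big_nat_recr //= /coprime gcdnn.
  have -> : (n.+1 == 1)%N = false by lia.
  rewrite addr0 [RHS]big_mkcond big_nat [RHS]big_nat; apply: eq_bigr => r r1.
  have -> : (n.+1 < n.+1 + r)%N by lia.
  by rewrite andbT gcdnC.
rewrite last_row big_split /=.
have regroup (a b c d e : rat) : a + c = d + e -> a + b + c = d + (e + b) by lra.
apply: regroup.
rewrite [X in _ + X = _]big_mkcond [X in _ = _ + X]big_mkcond /= -!big_split /=.
by rewrite big_nat [RHS]big_nat; apply: eq_bigr => q /row.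
Qed.

Lemma sum_coprime_rev (f : nat -> rat) (n : nat) :
  \sum_(1 <= q < n.+1 | coprime q n.+1) f (n.+1 - q)%N =
  \sum_(1 <= q < n.+1 | coprime q n.+1) f q.
Proof.
rewrite [RHS]big_nat_rev /= big_nat_cond [RHS]big_nat_cond.
apply: eq_big => [q|q _]; rewrite add1n subSS //.
case: (leqP q.+1 n.+1) => qn; rewrite ?andbF //.
have [k ->] : exists k, n.+1 = (k + q)%N by exists (n.+1 - q)%N; rewrite subnK // ltnW.
by rewrite addnK /coprime gcdnDl gcdnDr gcdnC.
Qed.

Definition coprime_harmonic (n : nat) : rat :=
  \sum_(1 <= q < n | coprime q n) q%:R^-1.

Definition inv_prod (q r : nat) : rat := (q%:R * r%:R)^-1.

Lemma inv_prod_split (n q : nat) : (1 <= q < n.+1)%N ->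
  inv_prod q (n.+1 - q) = (q%:R^-1 + (n.+1 - q)%:R^-1) / n.+1%:R.
Proof.
move=> /andP[q1 qn]; rewrite /inv_prod natrB 1?ltnW //.
have q0 : q%:R != 0 :> rat by rewrite pnatr_eq0; lia.
have n0 : n.+1%:R != 0 :> rat by rewrite pnatr_eq0.
have nq0 : n.+1%:R - q%:R != 0 :> rat by rewrite -natrB 1?ltnW // pnatr_eq0; lia.
move: n0 nq0; move: (n.+1%:R : rat) (q%:R : rat) q0 => m x x0 m0 mx0.
by field; rewrite x0 m0 mx0.
Qed.

Lemma sum_inv_prod_coprime (n : nat) :
  \sum_(1 <= q < n.+1 | coprime q n.+1) inv_prod q (n.+1 - q) =
  2 * coprime_harmonic n.+1 / n.+1%:R.
Proof.
rewrite mulr_natl mulr2n -[X in _ + X]sum_coprime_rev -big_split mulr_suml /=.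
rewrite big_nat_cond [RHS]big_nat_cond.
by apply: eq_bigr => q /andP[qn _]; exact: inv_prod_split.
Qed.

(** The terms are the lengths of the intervals cut out of [0, 1] by F_n. *)
Lemma pair_sum_inv_prod (n : nat) : (0 < n)%N -> pair_sum inv_prod n = 1.
Proof.
elim: n => [//|[_ _|n IHn _]].
  by rewrite /pair_sum big_nat1 big_mkcond big_nat1 /inv_prod /= mulr1 invr1.
have := @pair_sumS inv_prod n.+1 isT; rewrite IHn // sum_inv_prod_coprime.
suff -> : \sum_(1 <= q < n.+2 | coprime q n.+2) (inv_prod q n.+2 + inv_prod n.+2 q)
     = 2 * coprime_harmonic n.+2 / n.+2%:R by apply: addIr.
rewrite mulr_sumr mulr_suml; apply: eq_bigr => q _.
by rewrite /inv_prod (mulrC n.+2%:R) !invfM; ring.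
Qed.

Definition sqr_pair_sum (Q : nat) : rat := pair_sum (fun q r => inv_prod q r ^+ 2) Q.

(** Splitting an interval of length 1/(q r), with q + r = n+1, into two parts
    lowers the sum of squares by twice the product of the parts, which is
    2 / ((n+1)^2 q r); [sum_inv_prod_coprime] adds up these losses. *)
Lemma sqr_pair_sumS (n : nat) : (0 < n)%N ->
  sqr_pair_sum n.+1 = sqr_pair_sum n
    - 4 * coprime_harmonic n.+1 / n.+1%:R ^+ 3.
Proof.
move=> n0; rewrite /sqr_pair_sum.
have := pair_sumS (fun q r => inv_prod q r ^+ 2) n n0.
suff -> : \sum_(1 <= q < n.+1 | coprime q n.+1) inv_prod q (n.+1 - q) ^+ 2 =
   \sum_(1 <= q < n.+1 | coprime q n.+1) (inv_prod q n.+1 ^+ 2 + inv_prod n.+1 q ^+ 2)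
   + 4 * coprime_harmonic n.+1 / n.+1%:R ^+ 3.
  by rewrite addrCA [RHS]addrC => /addrI <-; rewrite addrK.
have nn0 : n.+1%:R != 0 :> rat by rewrite pnatr_eq0.
have -> : 4 * coprime_harmonic n.+1 / n.+1%:R ^+ 3 =
   2 / n.+1%:R ^+ 2 * (2 * coprime_harmonic n.+1 / n.+1%:R).
  by move: nn0; move: (n.+1%:R : rat) => m m0; field.
rewrite -sum_inv_prod_coprime mulr_sumr.
rewrite big_split /= -[X in _ + X + _]sum_coprime_rev -!big_split /=.
rewrite big_nat_cond [RHS]big_nat_cond; apply: eq_bigr => q /andP[/andP[q1 qn] _].
rewrite /inv_prod natrB 1?ltnW //.
have q0 : q%:R != 0 :> rat by rewrite pnatr_eq0; lia.
have nq0 : n.+1%:R - q%:R != 0 :> rat by rewrite -natrB 1?ltnW // pnatr_eq0; lia.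
move: nn0 nq0; move: (n.+1%:R : rat) (q%:R : rat) q0 => m x x0 m0 mx0.
by field; rewrite x0 m0 mx0.
Qed.

(** * A harmonic bound on the sum of squares *)

(** As q + r > n forces q r >= n, every term 1/(q r)^2 is at most 1/n times
    1/(q r), and the 1/(q r) add up to 1. *)
Lemma sqr_pair_sum_le_inv (n : nat) : (0 < n)%N -> sqr_pair_sum n <= n%:R^-1.
Proof.
move=> n0.
have -> : n%:R^-1 = pair_sum (fun q r => n%:R^-1 * inv_prod q r) n.
  rewrite -[LHS]mulr1 -(pair_sum_inv_prod _ n0) /pair_sum mulr_sumr.
  by apply: eq_bigr => q _; rewrite mulr_sumr.
apply: ler_pair_sum => q r q0 r0 nqr.
rewrite expr2 ler_pM2r /inv_prod -natrM ?invr_gt0 ?ltr0n ?muln_gt0 ?q0 //.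
rewrite lef_pV2 ?posrE ?ltr0n ?muln_gt0 ?q0 // ler_nat; nia.
Qed.

Definition harmonic_sum (n : nat) : rat := \sum_(1 <= k < n.+1) k%:R^-1.

(** The summand 1 absorbs the increment of the harmonic sum, so that the
    decrements of this sequence dominate the losses of [sqr_pair_sum]. *)
Definition harmonic_bound (n : nat) : rat := (2 * harmonic_sum n + 1) / n%:R ^+ 2.

Lemma coprime_harmonic_le (n : nat) : coprime_harmonic n.+1 <= harmonic_sum n.
Proof.
rewrite /coprime_harmonic big_mkcond; apply: ler_sum => q _.
by case: ifP; rewrite ?invr_ge0 ?ler0n.
Qed.

Lemma harmonic_ge0 (n : nat) : 0 <= harmonic_sum n.
Proof. by apply: sumr_ge0 => k _; rewrite invr_ge0 ler0n. Qed.

Lemma harmonic_bound_decrement (n : nat) : (0 < n)%N ->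
  4 * harmonic_sum n / n.+1%:R ^+ 3 <= harmonic_bound n - harmonic_bound n.+1.
Proof.
move=> n0; rewrite /harmonic_bound [harmonic_sum n.+1]big_nat_recr //=.
rewrite -/(harmonic_sum n).
have H0 := harmonic_ge0 n; set H := harmonic_sum n in H0 *.
have x0 : 0 < n%:R :> rat by rewrite ltr0n.
rewrite -[n.+1%:R]natr1; set x : rat := n%:R in x0 *.
have gap : 2 / (x + 1) ^+ 3 <= 1 / x ^+ 2 - 1 / (x + 1) ^+ 2.
  rewrite -subr_ge0.
  have -> : 1 / x ^+ 2 - 1 / (x + 1) ^+ 2 - 2 / (x + 1) ^+ 3 =
     (3 * x + 1) / (x ^+ 2 * (x + 1) ^+ 3) by field; lra.
  by rewrite divr_ge0 ?mulr_ge0 ?exprn_ge0; lra.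
rewrite -subr_ge0.
have -> : (2 * H + 1) / x ^+ 2 - (2 * (H + (x + 1)^-1) + 1) / (x + 1) ^+ 2
     - 4 * H / (x + 1) ^+ 3 =
   (2 * H + 1) * (1 / x ^+ 2 - 1 / (x + 1) ^+ 2 - 2 / (x + 1) ^+ 3)
   by field; lra.
by rewrite mulr_ge0; lra.
Qed.

(** The difference of the two sides is nondecreasing in n and bounded above by
    1/n, hence nowhere positive. *)
Lemma sqr_pair_sum_le (n : nat) : (0 < n)%N -> sqr_pair_sum n <= harmonic_bound n.
Proof.
move=> n0.
have mono k : sqr_pair_sum n - harmonic_bound n <=
    sqr_pair_sum (n + k)%N - harmonic_bound (n + k)%N.
  elim: k => [|k IHk]; first by rewrite addn0.
  apply: le_trans IHk _; have nk : (0 < n + k)%N by rewrite addn_gt0 n0.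
  rewrite addnS (sqr_pair_sumS _ nk).
  have c0 : 0 <= (n + k).+1%:R^-1 ^+ 3 :> rat by rewrite exprn_ge0 // invr_ge0 ler0n.
  have := ler_wpM2r c0 (coprime_harmonic_le (n + k)).
  have := harmonic_bound_decrement _ nk.
  rewrite exprVn; move: (coprime_harmonic _) (harmonic_sum _) (_ ^+ 3)^-1.
  move: (sqr_pair_sum _) (harmonic_bound _) (harmonic_bound _).
  by move=> s u v c H e; lra.
rewrite leNgt; apply/negP; rewrite -subr_gt0 => e0.
set e := sqr_pair_sum n - harmonic_bound n in mono e0.
have := archi_boundP (ltW (etrans (invr_gt0 e) e0)).
set k := Num.Def.archi_bound _ => ek.
have nk0 : (0 < n + k)%N by rewrite addn_gt0 n0.
have U0 : 0 <= harmonic_bound (n + k).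
  by rewrite divr_ge0 ?exprn_ge0 ?ler0n // addr_ge0 ?mulr_ge0 ?harmonic_ge0.
have : e <= (n + k)%:R^-1.
  by have := mono k; have := sqr_pair_sum_le_inv _ nk0; lra.
rewrite leNgt => /negP; apply; rewrite -[X in _ < X]invrK.
rewrite ltf_pV2 ?posrE ?invr_gt0 ?ltr0n //.
by apply: lt_le_trans ek _; rewrite ler_nat leq_addl.
Qed.

(** * The enumeration of the Farey fractions *)

Lemma mem_farey (Q : nat) (x : rat) :
  (x \in farey Q) = [&& 0 < x, x <= 1 & denq x <= Q%:Z].
Proof.
rewrite mem_sort; apply/allpairsPdep/and3P => [[q [a [qQ aq ->]]]|[x0 x1 xQ]].
  move: qQ aq; rewrite mem_filter !mem_iota => qQ /andP[caq aq].
  have q0 : 0 < q%:R :> rat by rewrite ltr0n; lia.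
  have a0 : 0 < a%:R :> rat by rewrite ltr0n; lia.
  rewrite divr_gt0 // ler_pdivrMr // mul1r ler_nat; split=> //; first by lia.
  have := @coprimeq_den a%:Z q%:Z caq; rewrite !pmulrn => ->.
  by rewrite eqz_nat; case: eqP; lia.
exists `|denq x|%N, `|numq x|%N.
have n0 : 0 < numq x by rewrite numq_gt0.
have d0 := denq_gt0 x.
have nd : numq x <= denq x by move: x1; rewrite /Order.le /= le_ratE mulr1 mul1r.
rewrite mem_filter !mem_iota coprime_num_den; split; [lia|lia|].
by rewrite !pmulrn !gtz0_abs // divq_num_den.
Qed.

Lemma farey_uniq (Q : nat) : uniq (farey Q).
Proof.
rewrite sort_uniq; apply: allpairs_uniq_dep; first exact: iota_uniq.
  by move=> q _; rewrite filter_uniq ?iota_uniq.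
move=> _ _ /allpairsPdep[q [a [qQ aq ->]]] /allpairsPdep[q' [a' [qQ' aq' ->]]] /=.
move: qQ aq qQ' aq'; rewrite !mem_filter !mem_iota.
move=> qQ /andP[caq aq] qQ' /andP[caq' aq']; rewrite !pmulrn => E.
have := congr1 denq E; rewrite !coprimeq_den // !eqz_nat.
case: eqP; first lia; case: eqP; first lia.
move=> _ _ [qq']; have := congr1 numq E; rewrite !coprimeq_num //.
rewrite !gtr0_sg ?mul1r => [[aa']||]; try lia.
by rewrite aa' qq'.
Qed.

Lemma farey_sorted (Q : nat) : sorted <%O (0 :: farey Q).
Proof.
have : sorted <%O (farey Q).
  by rewrite lt_sorted_uniq_le farey_uniq sort_le_sorted.
have : all (fun x => 0 < x) (farey Q) by apply/allP => x; rewrite mem_farey => /andP[].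
by case: (farey Q) => //= x s /andP[-> _].
Qed.

Lemma farey_last (Q : nat) : (0 < Q)%N ->
  (0 < farey_card Q)%N /\ (0 :: farey Q)`_(farey_card Q) = 1.
Proof.
move=> Q0; have m1 : 1 \in farey Q.
  by rewrite mem_farey ltr01 lexx -[1]/(1%:~R) denq_int.
have N0 : (0 < farey_card Q)%N by rewrite /farey_card; case: (farey Q) m1.
split=> //; apply/eqP; rewrite eq_le.
have mN : (0 :: farey Q)`_(farey_card Q) \in farey Q.
  by rewrite -(prednK N0) /= mem_nth // ltn_predL.
move: (mN); rewrite mem_farey => /and3P[_ -> _] /=.
have i1 : (index (1 : rat) (farey Q) < farey_card Q)%N by rewrite index_mem.
rewrite -[X in X <= _](nth_index 0 m1).
apply: (@le_sorted_leq_nth _ _ 0 (0 :: farey Q) _ (index (1:rat) (farey Q)).+1) => //.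
- by have := farey_sorted Q; rewrite lt_sorted_uniq_le => /andP[].
- by rewrite inE /= ltnS.
Qed.

(** Since the last Farey fraction is 1, the formula used beyond the first period
    is valid for all indices. *)
Lemma gammaE (Q j : nat) : (0 < Q)%N ->
  farey_gamma Q j = (0 :: farey Q)`_(j %% farey_card Q) + (j %/ farey_card Q)%:R.
Proof.
move=> /farey_last[N0 gN]; rewrite /farey_gamma leq_eqVlt.
have [->|_] := eqVneq j; first by rewrite gN modnn divnn N0 add0r.
by case: ltnP => //= jN; rewrite modn_small // divn_small // addr0.
Qed.

Lemma gammaDN (Q j : nat) : (0 < Q)%N ->
  farey_gamma Q (j + farey_card Q) = farey_gamma Q j + 1.
Proof.
move=> Q0; have [N0 _] := farey_last Q Q0.
by rewrite !gammaE // modnDr divnDr ?dvdnn // divnn N0 natrD addrA.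
Qed.

Lemma gamma_small (Q j : nat) : (j <= farey_card Q)%N ->
  farey_gamma Q j = (0 :: farey Q)`_j.
Proof. by rewrite /farey_gamma => ->. Qed.

Lemma gamma_lt (Q i j : nat) : (i < j <= farey_card Q)%N ->
  farey_gamma Q i < farey_gamma Q j.
Proof.
move=> /andP[ij jN]; rewrite !gamma_small //; last exact: leq_trans (ltnW ij) jN.
rewrite (lt_sorted_ltn_nth 0 (farey_sorted Q)) ?inE //=; rewrite ltnS //.
exact: leq_trans (ltnW ij) jN.
Qed.

Lemma gamma_bounds (Q j : nat) : (0 < Q)%N -> (j <= farey_card Q)%N ->
  [/\ 0 <= farey_gamma Q j, farey_gamma Q j <= 1 & denq (farey_gamma Q j) <= Q%:Z].
Proof.
move=> Q0 jN; rewrite gamma_small //; case: j jN => [|j] jN /=.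
  by rewrite -[0]/(0%:~R) denq_int.
by have := mem_nth 0 jN; rewrite mem_farey => /and3P[/ltW].
Qed.

Lemma gamma_adjacent (Q j : nat) : (0 < Q)%N -> (j < farey_card Q)%N ->
  let x := farey_gamma Q j in let y := farey_gamma Q j.+1 in
  numq y * denq x - numq x * denq y = 1 /\ Q%:Z < denq x + denq y.
Proof.
move=> Q0 jN x y.
have [x0 _ xQ] := gamma_bounds Q j Q0 (ltnW jN).
have [_ y1 yQ] := gamma_bounds Q j.+1 Q0 jN.
apply: farey_neighbours => //; first by apply: gamma_lt; rewrite ltnSn.
move=> z xz zQ; have [z1|/ltW] := leP z 1; last exact: le_trans.
have zF : z \in farey Q by rewrite mem_farey zQ z1 (le_lt_trans x0 xz).
pose k := (index z (farey Q)).+1.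
have kN : (k <= farey_card Q)%N by rewrite /k index_mem.
have kz : farey_gamma Q k = z by rewrite gamma_small //= nth_index.
rewrite -kz; case: (ltngtP k j.+1) => [kj|jk|->//].
  suff : farey_gamma Q k <= x by rewrite kz leNgt xz.
  move: kj; rewrite ltnS leq_eqVlt => /predU1P[->//|kj].
  by apply/ltW/gamma_lt; rewrite kj ltnW.
by apply/ltW/gamma_lt; rewrite jk.
Qed.

(** * Bounding the sum of squared h-gaps *)

Definition gap (Q j : nat) : rat := farey_gamma Q j.+1 - farey_gamma Q j.

Lemma sum_sqr_gap_le (Q : nat) : (0 < Q)%N ->
  \sum_(0 <= j < farey_card Q) gap Q j ^+ 2 <= sqr_pair_sum Q.
Proof.
move=> Q0; pose den j := `|denq (farey_gamma Q j)|%N.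
pose pairs := [seq (den j, den j.+1) | j <- iota 0 (farey_card Q)].
have -> : \sum_(0 <= j < farey_card Q) gap Q j ^+ 2 =
    \sum_(p <- pairs) inv_prod p.1 p.2 ^+ 2.
  rewrite big_map /index_iota subn0 big_seq [RHS]big_seq; apply: eq_bigr => j.
  rewrite mem_iota => /andP[_ jN]; have [det _] := gamma_adjacent _ _ Q0 jN.
  rewrite /gap (unimodular_diff _ _ det) /inv_prod !pmulrn /den /=.
  by rewrite !gtz0_abs ?denq_gt0.
rewrite /sqr_pair_sum pair_sum_seq.
apply: ler_sum_uniq_sub => [|||p]; last exact: sqr_ge0.
- rewrite map_inj_in_uniq ?iota_uniq // => i j.
  rewrite !mem_iota !add0n => /andP[_ iN] /andP[_ jN] [dij dij'].
  have bnd k : (k < farey_card Q)%N -> 0 <= farey_gamma Q k < 1.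
    move=> kN; have [-> _ _] := gamma_bounds _ _ Q0 (ltnW kN).
    have [_ ] := farey_last _ Q0; rewrite -gamma_small // => <-.
    by rewrite gamma_lt // kN /=.
  have [deti _] := gamma_adjacent _ _ Q0 iN.
  have [detj _] := gamma_adjacent _ _ Q0 jN.
  have dx : denq (farey_gamma Q i) = denq (farey_gamma Q j).
    by move: (congr1 Posz dij); rewrite /den !absz_denq.
  have dy : denq (farey_gamma Q i.+1) = denq (farey_gamma Q j.+1).
    by move: (congr1 Posz dij'); rewrite /den !absz_denq.
  have E := unimodular_inj _ _ _ _ (bnd i iN) (bnd j jN) deti detj dx dy.
  case: (ltngtP i j) => // ij.
    by have := gamma_lt Q i j; rewrite ij (ltnW jN) E ltxx => /(_ isT).
  by have := gamma_lt Q j i; rewrite ij (ltnW iN) E ltxx => /(_ isT).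
- apply: allpairs_uniq_dep => [|q _|]; [exact: iota_uniq|exact/filter_uniq/iota_uniq|].
  by move=> [q r] [q' r'] _ _ /= [-> ->].
move=> _ /mapP[j jN ->]; move: jN; rewrite mem_iota add0n => /andP[_ jN].
have [_ _ xQ] := gamma_bounds _ _ Q0 (ltnW jN).
have [_ _ yQ] := gamma_bounds _ _ Q0 jN.
have [det big] := gamma_adjacent _ _ Q0 jN.
apply/allpairsPdep; exists (den j), (den j.+1); rewrite mem_filter !mem_iota /den.
have dx := denq_gt0 (farey_gamma Q j); have dy := denq_gt0 (farey_gamma Q j.+1).
split=> //; first by lia.
apply/andP; split; last by lia.
apply/andP; split; last by lia.
apply/(coprimezP (denq _) (denq _)).
exists (numq (farey_gamma Q j.+1), - numq (farey_gamma Q j)) => /=.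
by rewrite -det; ring.
Qed.

Lemma sum_periodic (g : nat -> rat) (N i : nat) : (forall j, g (j + N)%N = g j) ->
  \sum_(0 <= j < N) g (j + i)%N = \sum_(0 <= j < N) g j.
Proof.
move=> per; elim: i => [|i IHi]; first by under eq_bigr do rewrite addn0.
rewrite -IHi; case: N per {IHi} => [|N] per; first by rewrite !big_geq.
rewrite big_nat_recr // [RHS]big_nat_recl //= addrC addnS addnC -addnS per.
by under [X in _ = _ + X]eq_bigr do rewrite addSnnS.
Qed.

Lemma sqr_sum_le (a : nat -> rat) (h : nat) :
  (\sum_(0 <= i < h) a i) ^+ 2 <= h%:R * \sum_(0 <= i < h) a i ^+ 2.
Proof.
elim: h => [|h IHh]; first by rewrite !big_geq // mul0r expr0n.
rewrite !big_nat_recr //=; move: IHh.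
have cross : 2 * (\sum_(0 <= i < h) a i) * a h <=
    \sum_(0 <= i < h) a i ^+ 2 + h%:R * a h ^+ 2.
  have -> : h%:R * a h ^+ 2 = \sum_(0 <= i < h) a h ^+ 2.
    by rewrite sumr_const_nat subn0 mulr_natl.
  rewrite -big_split -mulrA mulr_suml mulr_sumr; apply: ler_sum => i _ /=.
  by have := sqr_ge0 (a i - a h); lra.
by rewrite -natr1; lra.
Qed.

(** An h-gap is a sum of h consecutive gaps; Cauchy-Schwarz bounds its square,
    and by periodicity each of the h shifted sums of squares is D_(2,1). *)
Lemma D2_le (h Q : nat) : (0 < Q)%N -> D2 h Q <= h%:R ^+ 2 * sqr_pair_sum Q.
Proof.
move=> Q0; set N := farey_card Q.
have gapN j : gap Q (j + N) = gap Q j.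
  by rewrite /gap -addSn !gammaDN //; ring.
apply: (@le_trans _ _
  (\sum_(0 <= j < N) h%:R * \sum_(0 <= i < h) gap Q (j + i.+1) ^+ 2)).
  rewrite /D2 big_add1 /=; apply: ler_sum => j _.
  have -> : farey_gamma Q (j.+1 + h) - farey_gamma Q j.+1 =
      \sum_(0 <= i < h) gap Q (j + i.+1).
    have := @telescope_sumr _ 0 h (fun i => farey_gamma Q (j.+1 + i)) isT.
    rewrite addn0 => <-; apply: eq_bigr => i _.
    by rewrite /gap !addnS addSn.
  exact: sqr_sum_le.
rewrite -mulr_sumr exchange_big /=.
under eq_bigr => i _.
  rewrite (sum_periodic (fun j => gap Q j ^+ 2)); last by move=> j; rewrite gapN.
  over.
rewrite sumr_const_nat subn0 -[X in _ * X]mulr_natl mulrA -expr2.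
by rewrite ler_wpM2l ?exprn_ge0 // sum_sqr_gap_le.
Qed.

Lemma D2_2 (h : nat) : D2 h 2 = h%:R ^+ 2 / 2.
Proof.
have f2 : farey 2 = [:: 1 / 2; 1] by apply/eqP; vm_compute.
have g2 j : farey_gamma 2 j = j%:R / 2.
  rewrite gammaE // /farey_card f2 /= [in RHS](divn_eq j 2) natrD natrM.
  have : (j %% 2 < 2)%N by rewrite ltn_mod.
  by case: (j %% 2)%N => [|[|//]] _ /=; lra.
rewrite /D2 /farey_card f2 /index_iota /= !big_cons big_nil !g2 !natrD; lra.
Qed.

(** * Comparison with the logarithm *)

Lemma sqr_pair_sum1 : sqr_pair_sum 1 = 1.
Proof.
rewrite /sqr_pair_sum /pair_sum big_nat1 big_mkcond big_nat1.
by rewrite /inv_prod /= mulr1 invr1 expr1n.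
Qed.

Lemma sqr_pair_sum_decr (n : nat) : (0 < n)%N -> sqr_pair_sum n.+1 <= sqr_pair_sum n.
Proof.
move=> n0; rewrite sqr_pair_sumS // gerBl.
rewrite mulr_ge0 ?invr_ge0 ?exprn_ge0 ?ler0n // mulr_ge0 //.
by apply: sumr_ge0 => q _; rewrite invr_ge0 ler0n.
Qed.

Lemma coprime_harmonic_small :
  [/\ [/\ coprime_harmonic 2 = 1, coprime_harmonic 3 = 3 / 2,
          coprime_harmonic 4 = 4 / 3 & coprime_harmonic 5 = 25 / 12],
      [/\ coprime_harmonic 6 = 6 / 5, coprime_harmonic 7 = 49 / 20,
          coprime_harmonic 8 = 176 / 105 & coprime_harmonic 9 = 621 / 280]
    & [/\ coprime_harmonic 10 = 100 / 63, coprime_harmonic 11 = 7381 / 2520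
        & coprime_harmonic 12 = 552 / 385]].
Proof.
rewrite /coprime_harmonic; split; split; rewrite -big_filter.
all: match goal with |- context[\big[_/_]_(i <- ?l) _] =>
   let l' := eval vm_compute in l in change l with l' end.
all: by rewrite !big_cons big_nil; lra.
Qed.

(** The witness p is the integer part of 4 log n / log 2, so that p / 2 is a
    rational minorant of the target 2 log n / log 2, certified by 2^p <= n^4. *)
Lemma sqr_pair_sum_small (n : nat) : (2 <= n < 16)%N ->
  exists p : nat, (2 ^ p <= n ^ 4)%N /\ sqr_pair_sum n * n%:R ^+ 2 <= p%:R / 2.
Proof.
move=> n_range; have n_iota : n \in iota 2 14 by rewrite mem_iota.
have [[c2 c3 c4 c5] [c6 c7 c8 c9] [c10 c11 c12]] := coprime_harmonic_small.
have := sqr_pair_sum_decr; have := sqr_pair_sumS; have := sqr_pair_sum1.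
(* Abstracting the sums keeps conversion from evaluating them. *)
move: sqr_pair_sum => s s1 sS s_decr.
have S2 : s 2%N = 1 / 2 by rewrite (sS 1%N isT) s1 c2; clear; lra.
have S3 : s 3%N = 5 / 18 by rewrite (sS 2%N isT) S2 c3; clear; lra.
have S4 : s 4%N = 7 / 36 by rewrite (sS 3%N isT) S3 c4; clear; lra.
have S5 : s 5%N = 23 / 180 by rewrite (sS 4%N isT) S4 c5; clear; lra.
have S6 : s 6%N = 19 / 180 by rewrite (sS 5%N isT) S5 c6; clear; lra.
have S7 : s 7%N = 97 / 1260 by rewrite (sS 6%N isT) S6 c7; clear; lra.
have S8 : s 8%N = 23 / 360 by rewrite (sS 7%N isT) S7 c8; clear; lra.
(* Fractions with small denominators now replace the exact values; the bound
   1 / 30 at 12 is the one that the case n = 15 requires. *)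
have S9 : s 9%N <= 3 / 58 by rewrite (sS 8%N isT) S8 c9; clear; lra.
have S10 : s 10%N <= 59 / 1300.
  by rewrite (sS 9%N isT) c10; move: S9; clear; lra.
have S11 : s 11%N <= 3 / 82.
  by rewrite (sS 10%N isT) c11; move: S10; clear; lra.
have S12 : s 12%N <= 1 / 30.
  by rewrite (sS 11%N isT) c12; move: S11; clear; lra.
(* From here on the monotonicity of the sums is precise enough. *)
have S13 := le_trans (s_decr 12%N isT) S12.
have S14 := le_trans (s_decr 13%N isT) S13.
have S15 := le_trans (s_decr 14%N isT) S14.
clear -S2 S3 S4 S5 S6 S7 S8 S9 S10 S11 S12 S13 S14 S15 n_iota.
exists (nth 0 [:: 0; 0; 4; 6; 8; 9; 10; 11; 12; 12; 13; 13; 14; 14; 15; 15] n)%N.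
move: n_iota; rewrite /= !inE.
repeat (case/predU1P=> [->|]); last move/eqP=> ->.
all: split; [exact: isT | rewrite /=; lra].
Qed.

Lemma ln_le_of_expn (R : realType) (n p q : nat) : (0 < n)%N -> (2 ^ p <= n ^ q)%N ->
  p%:R * ln 2 <= q%:R * ln n%:R :> R.
Proof.
move=> n0 pq; rewrite !mulr_natl -!lnXn ?ltr0n //.
by rewrite ler_ln ?posrE ?exprn_gt0 ?ltr0n // -!natrX ler_nat.
Qed.

Lemma ln2_le1 (R : realType) : ln 2 <= 1 :> R.
Proof. have -> : 2 = 1 + 1 :> R by lra. by apply: le_ln1Dx; lra. Qed.

(** This is log (1 - 1/(n+1)) <= - 1/(n+1). *)
Lemma ln_succ_ge (R : realType) (n : nat) : (0 < n)%N ->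
  ln n%:R + n.+1%:R^-1 <= ln n.+1%:R :> R.
Proof.
move=> n0; have x0 : 0 < n%:R :> R by rewrite ltr0n.
have y0 : 0 < n.+1%:R :> R by rewrite ltr0n.
have v1 : n.+1%:R^-1 < 1 :> R by rewrite invf_lt1 // ltr1n.
have xE : n%:R = n.+1%:R * (1 + - n.+1%:R^-1) :> R.
  by rewrite -natr1; field; rewrite natr1; lra.
have vgt : -1 < - n.+1%:R^-1 :> R by rewrite ltrN2.
have := le_ln1Dx vgt; rewrite xE lnM ?posrE ?subr_gt0 //.
by rewrite -addrA gerDl -lerBrDr sub0r.
Qed.

(** One step adds 2 log 2 / (n+1) on the left, and at least 2 / (n+1) on the
    right; 16 is the first power of 2 at which the inequality holds. *)
Lemma harmonic_sum_ln (R : realType) (n : nat) : (16 <= n)%N ->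
  (2 * ratr (harmonic_sum n) + 1) * ln 2 <= 2 * ln n%:R :> R.
Proof.
have l2 := ln2_le1 R; have l20 : 0 < ln 2 :> R by rewrite ln_gt0 // ltr1n.
elim: n => [//|n IHn]; rewrite leq_eqVlt => /predU1P[<-|n16].
  have -> : ln 16%:R = 4 * ln 2 :> R.
    by have -> : 16%:R = 2 ^+ 4 :> R; [rewrite -natrX | rewrite lnXn // mulr_natl].
  have H16 : harmonic_sum 16 <= 7 / 2.
    by rewrite /harmonic_sum /index_iota /= !big_cons big_nil; lra.
  have : ratr (harmonic_sum 16) <= 7 / 2 :> R.
    rewrite -(ler_rat R) in H16; apply: le_trans H16 _.
    by rewrite fmorph_div /= !ratr_nat.
  nra.
have n0 : (0 < n)%N by lia.
rewrite /harmonic_sum big_nat_recr //= -/(harmonic_sum n) rmorphD fmorphV /= ratr_nat.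
have v0 : 0 <= n.+1%:R^-1 :> R by rewrite invr_ge0 ler0n.
have vl := ler_wpM2l v0 l2; have := ln_succ_ge R n n0; have := IHn n16; move: vl.
move: (ratr _) (n.+1%:R^-1) (ln 2) (ln n%:R) (ln n.+1%:R) => H v l a b; lra.
Qed.

Lemma sqr_pair_sum_ln (R : realType) (n : nat) : (2 <= n)%N ->
  ratr (sqr_pair_sum n) * n%:R ^+ 2 * ln 2 <= 2 * ln n%:R :> R.
Proof.
move=> n2; have l20 : 0 < ln 2 :> R by rewrite ln_gt0 // ltr1n.
have n0 : (0 < n)%N by lia.
have -> : ratr (sqr_pair_sum n) * n%:R ^+ 2 = ratr (sqr_pair_sum n * n%:R ^+ 2) :> R.
  by rewrite rmorphM rmorphXn /= ratr_nat.
case: (ltnP n 16) => [n16|n16].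
  have [|p [pn Sp]] := sqr_pair_sum_small n; first by rewrite n2.
  have := ln_le_of_expn R n p 4 n0 pn.
  rewrite -(ler_rat R) fmorph_div /= !ratr_nat in Sp.
  have := ler_wpM2r (ltW l20) Sp; lra.
apply: le_trans (harmonic_sum_ln R n n16); rewrite ler_pM2r //.
have -> : 2 * ratr (harmonic_sum n) + 1 = ratr (2 * harmonic_sum n + 1) :> R.
  by rewrite rmorphD rmorphM /= ratr_nat rmorph1.
have := sqr_pair_sum_le n n0; rewrite ler_rat /harmonic_bound.
by rewrite ler_pdivlMr ?exprn_gt0 ?ltr0n.
Qed.

Theorem theorem1p1 (R : realType) (h : nat) (h_ge1 : (1 <= h)%N) :
  (forall Q : nat, (2 <= Q)%N -> C R h Q <= 2 * h%:R ^+ 2 / ln 2) /\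
  C R h 2 = 2 * h%:R ^+ 2 / ln 2.
Proof.
have l20 : 0 < ln 2 :> R by rewrite ln_gt0 // ltr1n.
split=> [Q Q2|]; rewrite /C; last first.
  by rewrite D2_2 fmorph_div rmorphXn /= !ratr_nat; field; rewrite gt_eqF.
have lQ0 : 0 < ln Q%:R :> R by rewrite ln_gt0 // ltr1n.
rewrite ler_pdivrMr // [X in _ <= X]mulrAC ler_pdivlMr //.
have Q0 : (0 < Q)%N by lia.
have DS : ratr (D2 h Q) <= h%:R ^+ 2 * ratr (sqr_pair_sum Q) :> R.
  have := D2_le h Q Q0; rewrite -(ler_rat R) => /le_trans; apply.
  by rewrite rmorphM rmorphXn /= ratr_nat.
apply: (@le_trans _ _ (h%:R ^+ 2 * ratr (sqr_pair_sum Q) * Q%:R ^+ 2 * ln 2)).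
  by rewrite (ler_pM2r l20) ler_wpM2r ?exprn_ge0 ?ler0n.
have := ler_wpM2l (exprn_ge0 2 (ler0n R h)) (sqr_pair_sum_ln R Q Q2); lra.
Qed.
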